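(* Let $G_c=(V,E)$ be a connected weighted communication graph on $n$ nodes with distinct node ids and edge weights that need not be distinct, let $T_a$ be a minimum spanning tree of $G_c$ (the initial aggregation tree), and let $v_f\in V$ be a faulty node, of degree $k$ in $T_a$, such that the reduced communication graph $G'_c=(V',E')$, with $V'=V\setminus\{v_f\}$ and $E'=E\setminus\{\text{edges incident to } v_f\}$, is connected. Then the number of rounds used by the reconstruction algorithm (defined in the context) is $O(1)$ in the best case and $O(\log n)$ in the worst case. Precisely: (Best case) if in the first round every cluster other than the cluster $T_j$ of minimum id sends its merge request to $T_j$, then the tree is reconstructed in one round. (Worst case) the tree is always reconstructed after $O(\log k)$ rounds, hence after $O(\log n)$ rounds, with an absolute implied constant.
   Context: Edge weights are positive real communication costs (distances between sensor nodes); ties between edge weights are allowed. Reconstruction algorithm. Removing $v_f$ from $T_a$ leaves $k$ trees $T_1,\dots,T_k$, called clusters. The root of $T_i$ is initially its node that was adjacent to $v_f$ in $T_a$. At all times the id of a cluster is the id of its current root, so distinct clusters have distinct ids. The algorithm is synchronous and proceeds in rounds; each round consists of four subrounds. The final execution of Subround I that merely detects that no outgoing edge exists is not counted as a round. Subround I. Each cluster $T_i$ selects one minimum outgoing edge $\mathrm{moe}(T_i)$: an edge of $E'$ of minimum weight among all edges of $E'$ with exactly one endpoint in $T_i$. (Each node of the cluster finds its own minimum-weight edge leaving the cluster, ties at a single node being broken in favour of the smallest id of the other endpoint; the root then selects one edge of minimum weight among these, ties between different nodes being resolved arbitrarily.) If there is no outgoing edge, the algorithm terminates and the current tree is the output.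 Subround II. Each cluster $T_i$ sends a merge request along $\mathrm{moe}(T_i)$ to the cluster $T_j$ at its other end. If the id of $T_j$ is less than the id of $T_i$ the request is ignored; otherwise it is kept by $T_j$ (recorded at its root). Subround III. Each cluster sends exactly one merge message. If $T_j$ has kept at least one merge request, it sends its merge message to the cluster with minimum id among those whose requests it kept, along the edge on which that request arrived, and ignores the others. If $T_j$ has kept no request, it sends its merge message along $\mathrm{moe}(T_j)$. Subround IV. Suppose $T_i$ receives a merge message from $T_j$ along an edge $e$. (1) If $T_i$ also sent its merge message to $T_j$: if the id of $T_i$ is less than the id of $T_j$, then $T_i$ sends a commit message, $T_j$ merges with $T_i$ by including the edge $e$ in the tree, and the endpoints of $e$ start broadcasting over the new cluster a modify message carrying the root of $T_i$, which becomes the root (and gives the id) of the new cluster; if the id of $T_i$ is greater than the id of $T_j$, the received merge message is dropped. (2) If $T_i$ did not send its merge message to $T_j$: after $T_i$ has received a modify message from within its own cluster, it sends a commit message and forwards the modify message to $T_j$; then $T_j$ merges with $T_i$ by including the edge $e$ in the tree, and the nodes of $T_j$ adopt the root carried by the modify message. The algorithm is then repeated from Subround I with the resulting clusters, until termination. ''The tree is reconstructed'' means that only one cluster, spanning $V'$, remains. *)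

(* Defs.v *)
From mathcomp Require Import all_boot all_order all_algebra.
From mathcomp Require Import reals exp.
Set Implicit Arguments.
Unset Strict Implicit.
Unset Printing Implicit Defensive.

Import Order.TTheory GRing.Theory Num.Theory.
Local Open Scope ring_scope.

(** A graph on (a subset of) [V] is given by its set of edges, an edge being
    the two-element set of its endpoints. *)

Definition simple_graph (V : finType) (E : {set {set V}}) : Prop :=
  forall e, e \in E -> #|e| = 2%N.

Definition adj (V : finType) (E : {set {set V}}) : rel V :=
  [rel u v | [set u; v] \in E].

(* The graph without vertices is not connected. *)
Definition connected_graph (V : finType) (S : {set V}) (E : {set {set V}}) :
    Prop :=
  S != set0 /\ {in S &, forall u v, connect (adj E) u v}.

Definition acyclic (V : finType) (E : {set {set V}}) : Prop :=
  forall c : seq V, uniq c -> cycle (adj E) c -> (size c <= 2)%N.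

(* [T] is a spanning tree of the graph [(S, E)]. *)
Definition spanning_tree (V : finType) (S : {set V}) (E T : {set {set V}}) :
    Prop :=
  [/\ T \subset E, connected_graph S T & acyclic T].

Definition min_spanning_tree (R : realType) (V : finType) (S : {set V})
    (E : {set {set V}}) (w : {set V} -> R) (T : {set {set V}}) : Prop :=
  spanning_tree S E T /\
  forall T', spanning_tree S E T' -> \sum_(e in T) w e <= \sum_(e in T') w e.

Definition remove_vertex (V : finType) (x : V) (E : {set {set V}}) :
    {set {set V}} :=
  [set e in E | x \notin e].

Definition degree (V : finType) (E : {set {set V}}) (x : V) : nat :=
  #|[set u | adj E x u]|.

(** Between two rounds, the configuration consists of the edges of the current
    forest and of the root currently known to each node, i.e., the root of the
    cluster of that node.  As clusters are identified by their roots, a cluster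
    is denoted below by its root. *)

Record config (V : finType) := Config {
  tree : {set {set V}};
  node_root : V -> V
}.

(* The root of a component of [Ta - vf] is its node adjacent to [vf] in [Ta]
   (there is exactly one when [Ta] is a tree; the default value is only used
   at [vf], whose root is irrelevant). *)
Definition initial_config (V : finType) (Ta : {set {set V}}) (vf : V) :
    config V :=
  let F := remove_vertex vf Ta in
  Config F (fun v => odflt v [pick u | adj Ta vf u && connect (adj F) v u]).

Section Round.

(* [(V', E')] is the reduced graph, [w] its weights, [nid] the node ids. *)
Variables (R : realType) (V : finType) (V' : {set V}) (E' : {set {set V}}).
Variables (w : {set V} -> R) (nid : V -> nat).

Definition cluster_roots (s : config V) : {set V} :=
  [set node_root s v | v in V'].

Definition cluster_of (s : config V) (i : V) : {set V} :=
  [set v | connect (adj (tree s)) i v].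

(** Subround I *)

(* [{u, v}] leaves cluster [i], and [u] is its endpoint inside [i]. *)
Definition outgoing (s : config V) (i u v : V) : bool :=
  [&& u \in cluster_of s i, v \notin cluster_of s i & adj E' u v].

Definition terminated (s : config V) : Prop :=
  forall i u v, i \in cluster_roots s -> ~~ outgoing s i u v.

(* [{u, v}] is the edge that node [u] of cluster [i] proposes to its root. *)
Definition node_moe (s : config V) (i u v : V) : Prop :=
  outgoing s i u v /\
  forall v', outgoing s i u v' ->
    w [set u; v] < w [set u; v'] \/
    w [set u; v] = w [set u; v'] /\ (nid v <= nid v')%N.

(* [p] is a possible choice of moe(i), as the pair of its inner endpoint and
   its outer endpoint. *)
Definition is_moe (s : config V) (i : V) (p : V * V) : Prop :=
  node_moe s i p.1 p.2 /\
  forall u v, node_moe s i u v -> w [set p.1; p.2] <= w [set u; v].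

(* [m i] is the edge selected by cluster [i]. *)
Definition moe_choice (s : config V) (m : V -> V * V) : Prop :=
  forall i, i \in cluster_roots s -> is_moe s i (m i).

Definition moe_edge (m : V -> V * V) (i : V) : {set V} :=
  [set (m i).1; (m i).2].

(** Subround II *)

(* Cluster [i] sends its merge request to cluster [j]. *)
Definition request (s : config V) (m : V -> V * V) (i j : V) : Prop :=
  i \in cluster_roots s /\ node_root s (m i).2 = j.

Definition kept (s : config V) (m : V -> V * V) (i j : V) : Prop :=
  request s m i j /\ ~ (nid j < nid i)%N.

(** Subround III *)

(* [merge_msg s m j i e]: cluster [j] sends its merge message to cluster [i]
   along the edge [e]. *)
Inductive merge_msg (s : config V) (m : V -> V * V) (j : V) :
    V -> {set V} -> Prop :=
| MergeKept i :
    j \in cluster_roots s ->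
    kept s m i j -> (forall i', kept s m i' j -> (nid i <= nid i')%N) ->
    merge_msg s m j i (moe_edge m i)
| MergeMoe i :
    j \in cluster_roots s ->
    (forall i', ~ kept s m i' j) -> request s m j i ->
    merge_msg s m j i (moe_edge m j).

(** Subround IV *)

(* Clusters [i] and [j] sent their merge messages to each other, [j] along
   [e], and [i] has the smaller id. *)
Definition mutual (s : config V) (m : V -> V * V) (i j : V) (e : {set V}) :
    Prop :=
  [/\ merge_msg s m j i e, exists e', merge_msg s m i j e'
    & (nid i < nid j)%N].

(* Cluster [i] received along [e] a merge message from cluster [j], to which
   it did not send its own. *)
Definition one_way (s : config V) (m : V -> V * V) (i j : V) (e : {set V}) :
    Prop :=
  merge_msg s m j i e /\ ~ exists e', merge_msg s m i j e'.

(* [modify s m i r]: a modify message carrying the root [r] reaches the nodes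
   of cluster [i]. *)
Inductive modify (s : config V) (m : V -> V * V) : V -> V -> Prop :=
| ModifyLow i j e : mutual s m i j e -> modify s m i i
| ModifyHigh i j e : mutual s m i j e -> modify s m j i
| ModifyForward i j e r :
    one_way s m i j e -> modify s m i r -> modify s m j r.

(* After a commit message, the edge [e] is included in the tree. *)
Inductive included (s : config V) (m : V -> V * V) (e : {set V}) : Prop :=
| IncludeMutual i j : mutual s m i j e -> included s m e
| IncludeForward i j r :
    one_way s m i j e -> modify s m i r -> included s m e.

(* One round, from [s] to [s'], in which the clusters select the edges [m].
   The root at a node outside [V'] is left unconstrained. *)
Definition round (s : config V) (m : V -> V * V) (s' : config V) : Prop :=
  [/\ moe_choice s m,
      forall e, e \in tree s' <-> e \in tree s \/ included s m e,
      forall v r, v \in V' -> modify s m (node_root s v) r -> node_root s' v = r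
    & forall v, v \in V' -> (forall r, ~ modify s m (node_root s v) r) ->
        node_root s' v = node_root s v].

(* [execution s0 r s]: [r] rounds may lead from [s0] to [s]. *)
Inductive execution (s0 : config V) : nat -> config V -> Prop :=
| ExecNil : execution s0 0 s0
| ExecRound r s m s' :
    execution s0 r s -> round s m s' -> execution s0 r.+1 s'.

Definition reconstructed (s : config V) : Prop :=
  exists i, [/\ cluster_roots s = [set i], cluster_of s i = V'
              & spanning_tree V' E' (tree s)].

End Round.

(* Main.v *)
Require Import Defs.
From mathcomp Require Import all_boot all_order all_algebra.
From mathcomp Require Import boolp reals exp lra.
Set Implicit Arguments.
Unset Strict Implicit.
Unset Printing Implicit Defensive.
Import Order.TTheory GRing.Theory Num.Theory.
Local Open Scope ring_scope.

(** Every cluster [j] sends its merge message to exactly one cluster [f j].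
    If [f a] has a larger id than [a], then [f a] kept the request of [a], so
    [f (f a)] has an id at most that of [a].  Following [f] from any cluster,
    at steps of length one or two the ids thus decrease until one meets a pair
    [{r, f r}] with [f (f r) = r].  So the functional graph of [f] has no cycle
    except these pairs, which are exactly the mutual merges; every cluster hangs
    on one pair, and takes part in a merge.  Hence the number of clusters is at
    least halved by each round, and [2 ^ r <= k] after [r] rounds.  The new edges
    form a forest on the clusters, directed towards the leaders, so the tree
    remains acyclic. *)

(** * Acyclic graphs through bridges *)

Lemma adj_sym (V : finType) (T : {set {set V}}) : symmetric (adj T).
Proof. by move=> u v; rewrite /adj /= setUC. Qed.

Lemma connect_adj_sym (V : finType) (T : {set {set V}}) u v :
  connect (adj T) u v = connect (adj T) v u.
Proof. exact/sym_connect_sym/adj_sym. Qed.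

Lemma sub_connect_adj (V : finType) (T1 T2 : {set {set V}}) u v :
  T1 \subset T2 -> connect (adj T1) u v -> connect (adj T2) u v.
Proof.
move=> sT; apply: connect_sub => x y xy; apply: connect1.
exact: (subsetP sT).
Qed.

Lemma connect_ind (V : finType) (e : rel V) (P : V -> Prop) x y :
  connect e x y -> (forall u v, P u -> e u v -> P v) -> P x -> P y.
Proof.
move=> /connectP [p hp ->] step; elim: p x hp => //= z p IH x /andP [xz hp] Px.
exact: IH hp (step _ _ Px xz).
Qed.

Lemma set2_eqP (V : finType) (a b c d : V) :
  [set a; b] = [set c; d] -> (a = c /\ b = d) \/ (a = d /\ b = c).
Proof.
move=> eab.
have hc : c \in [set a; b] by rewrite eab set21.
have hd : d \in [set a; b] by rewrite eab set22.
have : b \in [set c; d] by rewrite -eab set22.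
have : a \in [set c; d] by rewrite -eab set21.
move=> /set2P [] ea /set2P [] eb; subst; [|by left|by right|].
  by left; move: hd => /set2P [].
by left; move: hc => /set2P [].
Qed.

(** Acyclicity restated through connectivity instead of cycles, so that adding an edge becomes a
    question about [connect]. *)
Definition all_bridges (V : finType) (T : {set {set V}}) : Prop :=
  forall a b, a != b -> adj T a b -> ~~ connect (adj (T :\ [set a; b])) a b.

(** A path from [a] to [b] avoiding the edge closes, once shortened, into a cycle of length at least
    three; conversely, a cycle of such length minus one edge is a path between the ends of that
    edge. *)
Lemma acyclic_all_bridges (V : finType) (T : {set {set V}}) :
  acyclic T <-> all_bridges T.
Proof.
split=> [acT a b nab Tab|bT [|x [|y [|z c]]] //].
  apply/negP => /connectP [p hp eb].
  case/shortenP: hp eb => p' hp' Up' _ eb.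
  have sub : path (adj T) a p'.
    apply: sub_path hp' => u v; rewrite /adj /= => /setD1P [] //.
  have := acT (a :: p') Up'.
  rewrite /= rcons_path sub -eb adj_sym Tab => /(_ isT).
  case: p' hp' eb {sub Up'} => [|y [|z p']] //=.
    by move=> _ eb; rewrite eb eqxx in nab.
  by move=> /andP [+ _] eb; rewrite -eb /adj /= setD11.
move=> /= Uc /and3P [xy yz hc]; exfalso.
have nxy : x != y by move: Uc; rewrite inE negb_or -andbA => /and3P [].
have /negP := bT x y nxy xy; apply.
rewrite connect_adj_sym; apply/connectP.
exists (z :: rcons c x); last by rewrite /= last_rcons.
have nxz : x != z by move: Uc; rewrite !inE !negb_or => /andP [/and3P [_ -> _] _].
have sTy u v : u != y -> v != y -> adj T u v -> adj (T :\ [set x; y]) u v.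
  move=> nu nv uv; rewrite /adj /=; apply/setD1P; split => //.
  by apply/eqP => /set2_eqP [] [eu ev]; rewrite ?eu ?ev eqxx in nu nv.
rewrite /=; apply/andP; split.
  rewrite /adj /=; apply/setD1P; split => //.
  apply/eqP => /set2_eqP [] [eu ev].
    by rewrite eu eqxx in nxy.
  by rewrite ev eqxx in nxz.
(* The rest of the cycle never meets [y] again, so it does not use the edge [[set x; y]]. *)
have := Uc => /= /and3P [_ /= ny _].
have nyc : all (predC1 y) (z :: rcons c x).
  apply/allP => u; rewrite inE mem_rcons inE => /or3P []; rewrite /= => hu.
  - by rewrite (eqP hu) eq_sym; move: ny; rewrite inE negb_or => /andP [].
  - by rewrite (eqP hu).
  - by apply: contraNneq ny => <-; rewrite inE hu orbT.
by apply: sub_in_path nyc hc => u v; apply: sTy.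
Qed.

Lemma acyclic_add_edge (V : finType) (T : {set {set V}}) u v :
  acyclic T -> ~~ connect (adj T) u v -> acyclic ([set u; v] |: T).
Proof.
move=> /acyclic_all_bridges bT nuv; apply/acyclic_all_bridges => a b nab.
rewrite /adj /= => /setU1P [eab|Tab].
  have sT : ([set u; v] |: T) :\ [set a; b] \subset T.
    by apply/subsetP => e; rewrite eab !inE; case: (e == _).
  apply: contra nuv => /(sub_connect_adj sT).
  by case: (set2_eqP eab) => -[-> ->] //; rewrite connect_adj_sym.
set T1 := T :\ [set a; b].
have sT1 : T1 \subset T by apply: subsetDl.
apply/negP => cab; have /negP := bT a b nab Tab; apply.
(* A path from [a] to [b] through [{u, v}] would close, with the edge [{a, b}],
   a path from [u] to [v] in [T]. *)
have cross p q : [set p; q] = [set u; v] -> connect (adj T1) a p ->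
    connect (adj T1) q b -> connect (adj T1) a b.
  move=> epq ap qb; exfalso; move/negP: nuv; apply.
  have pq : connect (adj T) p q.
    apply: (@connect_trans _ _ a).
      by rewrite connect_adj_sym; exact: sub_connect_adj sT1 ap.
    apply: connect_trans (connect1 Tab) _.
    by rewrite connect_adj_sym; exact: sub_connect_adj sT1 qb.
  by case: (set2_eqP epq) pq => -[-> ->] //; rewrite connect_adj_sym.
(* It suffices to record one crossing of the new edge: crossing it back returns to [p], already
   reached within [T1]. *)
have step x y : connect (adj T1) a x \/ (exists p q,
      [/\ [set p; q] = [set u; v], connect (adj T1) a p & connect (adj T1) q x]) ->
    adj (([set u; v] |: T) :\ [set a; b]) x y ->
    connect (adj T1) a y \/ (exists p q,
      [/\ [set p; q] = [set u; v], connect (adj T1) a p & connect (adj T1) q y]).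
  move=> hx /=; rewrite /adj /= => /setD1P [nxy /setU1P [exy|Txy]].
    case: hx => [ax|[p [q [epq ap qx]]]].
      by right; exists x, y.
    move: exy; rewrite -epq => /set2_eqP [] [ex ey]; subst.
      by right; exists p, q.
    by left.
  have xy : adj T1 x y by apply/setD1P.
  case: hx => [ax|[p [q [epq ap qx]]]].
    by left; apply: connect_trans ax (connect1 xy).
  by right; exists p, q; split=> //; apply: connect_trans qx (connect1 xy).
have [//|[p [q [epq ap qb]]]] := connect_ind cab step (or_introl (connect0 _ _)).
exact: cross epq ap qb.
Qed.

(* The edge attached at an element of maximal depth [d] is a bridge, which
   gives an induction on [J]. *)
Lemma acyclic_attach (V : finType) (T : {set {set V}}) (cls eu ev : V -> V)
    (d : V -> nat) (J : {set V}) :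
  acyclic T -> (forall x y, adj T x y -> cls x = cls y) ->
  (forall j, j \in J -> cls (eu j) = j) ->
  (forall j, j \in J -> (d (cls (ev j)) < d j)%N) ->
  acyclic (T :|: [set [set eu j; ev j] | j in J]).
Proof.
move=> acT clsT; have [n] := ubnP #|J|; elim: n J => // n IH J leJ euJ evJ.
have [->|[j0 j0J]] := set_0Vmem J; first by rewrite imset0 setU0.
have [j jJ' jmax] := arg_maxnP d j0J; have {jJ'}jJ : j \in J := jJ'.
have -> : T :|: [set [set eu j; ev j] | j in J] =
    [set eu j; ev j] |: (T :|: [set [set eu j; ev j] | j in J :\ j]).
  by rewrite -{1}(setD1K jJ) imsetU1 setUCA.
apply: acyclic_add_edge.
  apply: IH.
  - by move: leJ; rewrite (cardsD1 j) jJ.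
  - by move=> i /setD1P [_ /euJ].
  - by move=> i /setD1P [_ /evJ].
apply/negP => cj.
suff: cls (ev j) = j by move=> ej; have := evJ j jJ; rewrite ej ltnn.
(* No path leaves class [j]: edges of [T] preserve [cls], and an edge of another [i] attached to
   class [j] would give [d j < d i], against maximality. *)
apply: (connect_ind (P := fun x => cls x = j) cj); last exact: euJ.
move=> x y xj; rewrite /adj /= => /setUP [/clsT <- //|/imsetP [i]].
move=> /setD1P [nij iJ] /set2_eqP [] [ex ey]; subst x y.
  by rewrite euJ // in xj; rewrite xj eqxx in nij.
by have := jmax i iJ; rewrite /= leqNgt -{1}xj evJ.
Qed.

(** * The functional graph of merge messages *)

Section MergeGraph.
Variables (V : finType) (nid : V -> nat) (C : {set V}) (f : V -> V).
Hypothesis nid_inj : injective nid.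
Hypothesis fC : forall j, j \in C -> f j \in C.
Hypothesis f_neq : forall j, j \in C -> f j != j.
Hypothesis f_ascent : forall a,
  a \in C -> (nid a < nid (f a))%N -> (nid (f (f a)) <= nid a)%N.

(* The member with the smaller id of a pair of clusters merging mutually. *)
Definition leader r := (f (f r) == r) && (nid r < nid (f r))%N.

Lemma iter_leader j : j \in C -> exists n, leader (iter n f j).
Proof.
have [n] := ubnP (nid j); elim: n j => // n IH j lejn jC.
have [ltfj|lefj] := ltnP (nid (f j)) (nid j).
  have [k hk] := IH (f j) (leq_trans ltfj lejn) (fC jC).
  by exists k.+1; rewrite iterSr.
have ltj : (nid j < nid (f j))%N.
  by rewrite ltn_neqAle lefj andbT; apply: contraNneq (f_neq jC) => /nid_inj <-.
have := f_ascent jC ltj; rewrite leq_eqVlt => /orP [/eqP /nid_inj ej|ltff].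
  by exists 0; rewrite /leader /= ej eqxx.
have [k hk] := IH (f (f j)) (leq_trans ltff lejn) (fC (fC jC)).
by exists k.+2; rewrite !iterSr.
Qed.

(* [d] is the distance to the leader and [rt] the leader itself. *)
Lemma merge_forest : exists (d : V -> nat) (rt : V -> V), forall j, j \in C ->
  if leader j then rt j = j else (d (f j) < d j)%N /\ rt (f j) = rt j.
Proof.
(* The default 0 only concerns elements none of whose iterates is a leader, hence elements outside
   [C]. *)
pose d j := if pselect (exists n, leader (iter n f j)) is left h
  then ex_minn h else 0%N.
have dP j : j \in C -> leader (iter (d j) f j) /\
    forall n, leader (iter n f j) -> (d j <= n)%N.
  move=> /iter_leader hj; rewrite /d; case: pselect => // h.
  by case: ex_minnP.
exists d, (fun j => iter (d j) f j) => j jC.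
have [dj minj] := dP j jC; have [dfj minfj] := dP (f j) (fC jC).
case: ifPn => lj.
  by have := minj 0%N lj; rewrite leqn0 => /eqP ->.
case Ed: (d j) dj => [|n]; first by rewrite /= (negPf lj).
rewrite iterSr => /minfj le1.
have := minj (d (f j)).+1; rewrite iterSr Ed => /(_ dfj) le2.
(* One step along [f] shortens the distance by exactly one, so [j] and [f j] reach the same
   leader. *)
suff -> : d (f j) = n by [].
by apply/eqP; rewrite eqn_leq le1.
Qed.

Lemma leader_root (d : V -> nat) (rt : V -> V) :
  (forall j, j \in C ->
    if leader j then rt j = j else (d (f j) < d j)%N /\ rt (f j) = rt j) ->
  forall j, j \in C -> rt j \in C /\ leader (rt j).
Proof.
move=> h j; have [n] := ubnP (d j); elim: n j => // n IH j lejn jC.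
have := h j jC; case: ifPn => [lj -> //|lj [ltd <-]].
by apply: IH (fC jC); apply: leq_trans ltd _.
Qed.

(** Each leader [r] is paired with [f r]: the partners are distinct because [f (f r) = r], and none
    is a leader because its id exceeds that of [r]. *)
Lemma leader_half (A : {set V}) :
  (forall r, r \in A -> r \in C /\ leader r) -> (#|A| * 2 <= #|C|)%N.
Proof.
move=> hA.
have f_inj : {in A &, injective f}.
  move=> r r' /hA [_ /andP [/eqP er _]] /hA [_ /andP [/eqP er' _]] e.
  by rewrite -er -er' e.
have dis : [disjoint A & f @: A].
  rewrite disjoints_subset; apply/subsetP => r rA; rewrite inE.
  apply/imsetP => -[r' /hA [_ /andP [/eqP er lt']] e].
  have [_ /andP [_]] := hA r rA.
  by rewrite e er ltnNge ltnW.
rewrite muln2 -addnn -{2}(card_in_imset f_inj) -cardsUI.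
move: dis; rewrite -setI_eq0 => /eqP ->; rewrite cards0 addn0.
apply: subset_leq_card; apply/subsetP => x /setUP [/hA [] //|].
by move=> /imsetP [r /hA [rC _] ->]; exact: fC.
Qed.
End MergeGraph.

(** * Clusterings and the effect of one round *)

Section OneRound.
Variables (R : realType) (V : finType) (V' : {set V}) (E' : {set {set V}}).
Variables (w : {set V} -> R) (nid : V -> nat).
Hypothesis nid_inj : injective nid.
Hypothesis E'V' : forall u v, adj E' u v -> v \in V'.

(** The invariant of executions. By [root_connect] and [root_adj], two nodes of [V'] have the same
    root exactly when they lie in the same component of the forest. *)
Record clustering (s : config V) : Prop := Clustering {
  tree_edge : tree s \subset E';
  tree_acyclic : acyclic (tree s);
  root_in : forall v, v \in V' -> node_root s v \in V';
  root_connect : forall v, v \in V' -> connect (adj (tree s)) (node_root s v) v;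
  root_adj : forall u v, adj (tree s) u v -> node_root s u = node_root s v
}.

Lemma root_connected s u v :
  clustering s -> connect (adj (tree s)) u v -> node_root s u = node_root s v.
Proof.
move=> hs uv; pose P x := node_root s u = node_root s x.
by apply: (connect_ind (P := P) uv) => // x y; rewrite /P => -> /(root_adj hs).
Qed.

Lemma root_idem s v :
  clustering s -> v \in V' -> node_root s (node_root s v) = node_root s v.
Proof. by move=> hs vV; exact: root_connected hs (root_connect hs vV). Qed.

Lemma cluster_rootsP s i : clustering s ->
  i \in cluster_roots V' s <-> i \in V' /\ node_root s i = i.
Proof.
move=> hs; split=> [/imsetP [v vV ->]|[iV <-]]; last exact: imset_f.
by split; [exact: root_in | exact: root_idem].
Qed.

Lemma in_cluster_of s i v : clustering s -> i \in cluster_roots V' s ->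
  (v \in cluster_of s i) = (v \in V') && (node_root s v == i).
Proof.
move=> hs /(cluster_rootsP _ hs) [iV ei]; rewrite inE.
apply/idP/andP => [iv|[vV /eqP <-]]; last exact: root_connect.
split; last by rewrite -(root_connected hs iv) ei.
apply: (connect_ind (P := fun x => x \in V') iv) => // x y _ xy.
by apply: (E'V' (u := x)); exact: (subsetP (tree_edge hs)).
Qed.

Lemma outgoingE s i u v : clustering s -> i \in cluster_roots V' s ->
  outgoing E' s i u v =
  [&& adj E' u v, node_root s u == i & node_root s v != i].
Proof.
move=> hs iC; rewrite /outgoing !in_cluster_of //.
have [uv|] := boolP (adj E' u v); last by rewrite !andbF.
have -> : v \in V' := E'V' uv.
have -> : u \in V' by apply: (E'V' (u := v)); rewrite adj_sym.
by rewrite andbT.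
Qed.

(** * The merge messages as a function *)

Section Target.
Variables (s : config V) (m : V -> V * V).
Hypothesis hs : clustering s.
Local Notation C := (cluster_roots V' s).
Hypothesis hm : forall i, i \in C -> outgoing E' s i (m i).1 (m i).2.

Definition keptb i j :=
  [&& i \in C, node_root s (m i).2 == j & ~~ (nid j < nid i)%N].

Lemma keptP i j : reflect (kept V' nid s m i j) (keptb i j).
Proof.
apply: (iffP and3P) => [[iC /eqP ij /negP]|[[iC ij] /negP]] //.
by split=> //; apply/eqP.
Qed.

(** Functional form of [merge_msg] (see [merge_msgP]); [pick] decides whether some request was kept
    and gives the starting point of the minimum. *)
Definition target j :=
  if [pick i | keptb i j] is Some i0 then [arg min_(i < i0 | keptb i j) nid i]
  else node_root s (m j).2.

(* The edge of the merge message of [j], oriented from [j] to [target j]. *)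
Definition merge_ends j : V * V :=
  if [exists i, keptb i j] then ((m (target j)).2, (m (target j)).1) else m j.

Definition merge_edge j : {set V} := [set (merge_ends j).1; (merge_ends j).2].

(** [target] and [merge_ends] test the same condition, so one case analysis serves both. In the
    first case the edge is reversed, since [m i] is oriented from [i] to [j]. *)
Variant target_spec j : V -> V * V -> Prop :=
| TargetKept i : keptb i j -> (forall i', keptb i' j -> (nid i <= nid i')%N) ->
    target_spec j i ((m i).2, (m i).1)
| TargetMoe : (forall i, ~~ keptb i j) ->
    target_spec j (node_root s (m j).2) (m j).

Lemma targetP j : target_spec j (target j) (merge_ends j).
Proof.
rewrite /merge_ends /target; case: pickP => [i0 ki0|nk].
  case: arg_minnP => // i ki mini.
  have -> : [exists i, keptb i j] by apply/existsP; exists i.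
  exact: TargetKept.
have -> : [exists i, keptb i j] = false.
  by apply/existsP => -[i]; rewrite nk.
by apply: TargetMoe => i; rewrite nk.
Qed.

Lemma moe_outP i : i \in C ->
  [/\ adj E' (m i).1 (m i).2, node_root s (m i).1 = i & node_root s (m i).2 != i].
Proof.
by move=> iC; have := hm iC; rewrite outgoingE // => /and3P [? /eqP ? ?].
Qed.

Lemma merge_endsP j : j \in C ->
  [/\ adj E' (merge_ends j).1 (merge_ends j).2, node_root s (merge_ends j).1 = j
    & node_root s (merge_ends j).2 = target j].
Proof.
move=> jC; case: targetP => [i /and3P [/moe_outP [h1 h2 h3] /eqP ij _] _|_] /=.
  by rewrite adj_sym.
by have [] := moe_outP jC.
Qed.

Lemma target_root j : j \in C -> target j \in C.
Proof.
move=> /merge_endsP [ha _ <-]; apply: imset_f; exact: E'V' ha.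
Qed.

Lemma target_neq j : j \in C -> target j != j.
Proof.
move=> jC; case: targetP => [i /and3P [iC /eqP ij _] _|_].
  by have [_ _] := moe_outP iC; rewrite ij eq_sym.
by have [] := moe_outP jC.
Qed.

(** A kept request comes from an id at most that of the keeper, so if the message of [a] ascends, it
    follows the moe of [a]. Its receiver has then kept the request of [a] and answers a sender of
    minimum id. *)
Lemma target_ascent a : a \in C -> (nid a < nid (target a))%N ->
  (nid (target (target a)) <= nid a)%N.
Proof.
move=> aC; case: (targetP a) => [i /and3P [_ _ /negP h] _ /h //|_ lt].
have ka : keptb a (node_root s (m a).2).
  by rewrite /keptb aC eqxx -leqNgt ltnW.
by case: targetP => [i _ /(_ _ ka) //|/(_ a)]; rewrite ka.
Qed.

Lemma merge_msgP j i e : merge_msg V' nid s m j i e <->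
  [/\ j \in C, i = target j & e = merge_edge j].
Proof.
rewrite /merge_edge; split.
  case=> [{}i jC ki mini|{}i jC nk [_ <-]]; case: targetP.
  - move=> i' ki' mini'; suff -> : i = i' by split=> //; rewrite setUC.
    apply: nid_inj; apply/eqP; rewrite eqn_leq mini' ?andbT //; last exact/keptP.
    by apply: mini; apply/keptP.
  - by move=> /(_ i) /keptP.
  - by move=> i' /keptP /nk.
  - by [].
move=> [jC -> ->]; case: targetP => [i' ki mini|nk] /=.
  rewrite setUC; apply: MergeKept => //; first exact/keptP.
  by move=> i'' /keptP /mini.
by apply: MergeMoe => // i' /keptP; apply/negP.
Qed.

Local Notation lead := (leader nid target).

Lemma mutualP i j e : mutual V' nid s m i j e <->
  [/\ i \in C, lead i, j = target i & e = merge_edge j].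
Proof.
rewrite /leader; split.
  by move=> [/merge_msgP [jC -> ->] [_ /merge_msgP [iC ej _]] lt]; rewrite -ej eqxx.
move=> [iC /andP [/eqP ei lt] -> ->]; split=> //.
  by apply/merge_msgP; split=> //; exact: target_root.
by exists (merge_edge i); apply/merge_msgP.
Qed.

Lemma one_wayP i j e : one_way V' nid s m i j e <->
  [/\ j \in C, i = target j, target i != j & e = merge_edge j].
Proof.
split=> [[/merge_msgP [jC -> ->] nm]|[jC -> nij ->]].
  split=> //; apply/eqP => ej; apply: nm; exists (merge_edge (target j)).
  by apply/merge_msgP; split=> //; exact: target_root.
split; first exact/merge_msgP.
by move=> [e' /merge_msgP [_ ej _]]; rewrite -ej eqxx in nij.
Qed.

(** * The forest of merges and the resulting configuration *)

Section Forest.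
Variables (d : V -> nat) (rt : V -> V).
Hypothesis hrt : forall j, j \in C ->
  if lead j then rt j = j
  else (d (target j) < d j)%N /\ rt (target j) = rt j.

Lemma leader_partner i : lead i -> ~~ lead (target i).
Proof.
by move=> /andP [/eqP ei lt]; rewrite /leader ei eqxx -leqNgt ltnW.
Qed.

Lemma nonleader_mutual j : j \in C -> ~~ lead j -> target (target j) = j ->
  lead (target j).
Proof.
move=> jC; rewrite /leader => nl ej; rewrite ej !eqxx /= in nl *.
rewrite ltn_neqAle leqNgt nl andbT.
by apply: contraNneq (target_neq jC) => /nid_inj ->.
Qed.

(** Modify messages start at the mutual pairs and travel against [target], along which [rt] is
    constant; induction on the distance [d] shows that they reach every cluster. *)
Lemma modifyP j r : modify V' nid s m j r <-> j \in C /\ r = rt j.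
Proof.
split=> [|[]].
  elim=> [i k e /mutualP [iC li _ _]|i k e /mutualP [iC li -> _]|
      i k e q /one_wayP [kC -> nk _] _ [_ ->]].
  - by split=> //; have := hrt iC; rewrite li => ->.
  - split; first exact: target_root.
    have := hrt (target_root iC); rewrite (negPf (leader_partner li)) => -[_ <-].
    by have := hrt iC; have /andP [/eqP -> _] := li; rewrite li => ->.
  - split=> //; have := hrt kC; case: ifP => [/andP [ek]|_ [] //].
    by rewrite ek in nk.
have [n] := ubnP (d j); elim: n j r => // n IH j r lejn jC ->.
have := hrt jC; have tjC := target_root jC; case: ifPn => [lj ->|lj [ltd <-]].
  by apply: (@ModifyLow _ _ _ _ _ _ (target j) (merge_edge (target j))); apply/mutualP.
have [ej|nej] := eqVneq (target (target j)) j.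
  have lt := nonleader_mutual jC lj ej.
  have := hrt tjC; rewrite lt => ->.
  by apply: (ModifyHigh (e := merge_edge j)); apply/mutualP.
apply: (@ModifyForward _ _ _ _ _ (target j) _ (merge_edge j)).
  exact/one_wayP.
by apply: IH => //; apply: leq_trans ltd _.
Qed.

(** A mutual pair includes only the edge of the message sent by its larger id, so each non-leader
    contributes its own merge edge and leaders contribute none. *)
Lemma includedP e : included V' nid s m e <->
  exists j, [/\ j \in C, ~~ lead j & e = merge_edge j].
Proof.
split=> [[i j /mutualP [iC li -> ->]|i j r /one_wayP [jC ei nj ->] _]|].
- exists (target i); split=> //; first exact: target_root.
  exact: leader_partner.
- exists j; split=> //; by rewrite /leader -ei (negPf nj).
move=> [j [jC lj ->]]; have tjC := target_root jC.
have [ej|nej] := eqVneq (target (target j)) j.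
  by apply: (IncludeMutual (i := target j) (j := j)); apply/mutualP;
    split=> //; exact: nonleader_mutual.
apply: (@IncludeForward _ _ _ _ _ _ (target j) j (rt (target j))).
  exact/one_wayP.
exact/modifyP.
Qed.

Definition merged_tree : {set {set V}} :=
  tree s :|: [set merge_edge j | j in [set j in C | ~~ lead j]].

(** Every cluster receives a modify message, and only one carrying its [rt], so the choice [m]
    determines the new tree and the new roots on [V']. *)
Lemma roundP s' : round V' E' w nid s m s' <->
  [/\ moe_choice V' E' w nid s m, tree s' = merged_tree
    & forall v, v \in V' -> node_root s' v = rt (node_root s v)].
Proof.
have inclP e : included V' nid s m e <->
    e \in [set merge_edge j | j in [set j in C | ~~ lead j]].
  split=> [/includedP [j [jC lj ->]]|/imsetP [j]].
    by apply: imset_f; rewrite inE jC.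
  by rewrite inE => /andP [jC lj] ->; apply/includedP; exists j.
have rC v : v \in V' -> node_root s v \in C by move=> vV; exact: imset_f.
split=> [[hmoe ht hr _]|[hmoe ht hr]]; split=> //.
- apply/setP => e; rewrite inE; apply/idP/orP => [/ht [|/inclP]|he].
  + by left.
  + by right.
  + by apply/ht; case: he => [|/inclP]; [left|right].
- by move=> v vV; apply: hr => //; apply/modifyP; split=> //; exact: rC.
- move=> e; rewrite ht inE; split=> [/orP [|/inclP]|he].
  + by left.
  + by right.
  + by apply/orP; case: he => [|/inclP]; [left|right].
- by move=> v r vV /modifyP [_ ->]; exact: hr.
- move=> v vV nr; exfalso; apply: (nr (rt (node_root s v))).
  by apply/modifyP; split=> //; exact: rC.
Qed.

Lemma merged_connect s' j : tree s' = merged_tree -> j \in C ->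
  connect (adj (tree s')) (rt j) j.
Proof.
move=> ht; have [n] := ubnP (d j); elim: n j => // n IH j lejn jC.
have := hrt jC; have tjC := target_root jC; case: ifPn => [_ ->|lj [ltd <-]].
  exact: connect0.
have sT : tree s \subset tree s' by rewrite ht subsetUl.
have [ha e1 e2] := merge_endsP jC.
have v1 : (merge_ends j).1 \in V'.
  by apply: (E'V' (u := (merge_ends j).2)); rewrite adj_sym.
have v2 := E'V' ha.
(* The path goes from [rt j] to [target j] by induction, then inside that cluster to the merge edge,
   across it, and inside cluster [j] to [j]. *)
apply: connect_trans (IH _ (leq_trans ltd lejn) tjC) _.
rewrite -e2; apply: connect_trans (sub_connect_adj sT (root_connect hs v2)) _.
apply: connect_trans (connect1 (y := (merge_ends j).1) _) _.
  rewrite adj_sym /adj /= ht; apply/setUP; right.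
  by apply: (imset_f merge_edge); rewrite inE jC.
rewrite -{2}e1 connect_adj_sym; apply: sub_connect_adj sT _.
exact: root_connect.
Qed.

Lemma merged_clustering s' : tree s' = merged_tree ->
  (forall v, v \in V' -> node_root s' v = rt (node_root s v)) ->
  clustering s' /\ (#|cluster_roots V' s'| * 2 <= #|C|)%N.
Proof.
move=> ht hr.
have rC v : v \in V' -> node_root s v \in C by move=> vV; exact: imset_f.
have lr := leader_root target_root hrt.
have sT : tree s \subset tree s' by rewrite ht subsetUl.
split; last first.
  (* The roots after the round are leaders, hence at most half of the clusters. *)
  apply: (leader_half target_root) => r /imsetP [v vV ->].
  by rewrite hr //; apply: lr; exact: rC.
split.
- rewrite ht subUset (tree_edge hs) /=; apply/subsetP => _ /imsetP [j + ->].
  by rewrite inE => /andP [/merge_endsP [ha _ _] _].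
(* The classes are the old clusters, and each merge edge leads to a cluster closer to its leader. *)
- rewrite ht; apply: (acyclic_attach (cls := node_root s) (d := d)).
  + exact: tree_acyclic.
  + exact: root_adj.
  + by move=> j; rewrite inE => /andP [/merge_endsP []].
  + move=> j; rewrite inE => /andP [jC lj]; have [_ _ ->] := merge_endsP jC.
    by have := hrt jC; rewrite (negPf lj) => -[].
- move=> v vV; rewrite hr //.
  by have [/(cluster_rootsP _ hs) []] := lr _ (rC v vV).
- move=> v vV; rewrite hr //; apply: connect_trans (merged_connect ht (rC v vV)) _.
  exact: sub_connect_adj sT (root_connect hs vV).
- move=> u v; rewrite /adj /= ht => /setUP [uv|/imsetP [j]].
    have uvE : adj E' u v by exact: (subsetP (tree_edge hs)).
    rewrite !hr ?(root_adj hs uv) //; first exact: E'V' uvE.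
    by apply: (E'V' (u := v)); rewrite adj_sym.
  rewrite inE => /andP [jC lj]; have [ha e1 e2] := merge_endsP jC.
  have v1 : (merge_ends j).1 \in V'
    by apply: (E'V' (u := (merge_ends j).2)); rewrite adj_sym.
  have v2 := E'V' ha.
  have := hrt jC; rewrite (negPf lj) => -[_ ej].
  by move=> /set2_eqP [] [-> ->]; rewrite !hr // e1 e2 ej.
Qed.

End Forest.

Lemma exists_forest : exists (d : V -> nat) (rt : V -> V), forall j, j \in C ->
  if lead j then rt j = j else (d (target j) < d j)%N /\ rt (target j) = rt j.
Proof. exact: merge_forest nid_inj target_root target_neq target_ascent. Qed.

End Target.

(** * Rounds and executions preserve the invariant and halve the clusters *)

Lemma moe_choice_outgoing s m : moe_choice V' E' w nid s m ->
  forall i, i \in cluster_roots V' s -> outgoing E' s i (m i).1 (m i).2.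
Proof. by move=> hm i /hm [[]]. Qed.

Lemma round_clustering s m s' : clustering s -> round V' E' w nid s m s' ->
  clustering s' /\ (#|cluster_roots V' s'| * 2 <= #|cluster_roots V' s|)%N.
Proof.
move=> hs hround; have [hm _ _ _] := hround.
have ho := moe_choice_outgoing hm.
have [d [rt hrt]] := exists_forest hs ho.
have [_ ht hr] := (roundP hs ho hrt s').1 hround.
exact: (merged_clustering hs ho hrt ht hr).
Qed.

Lemma round_exists s m : clustering s -> moe_choice V' E' w nid s m ->
  exists s', round V' E' w nid s m s'.
Proof.
move=> hs hm; have ho := moe_choice_outgoing hm.
have [d [rt hrt]] := exists_forest hs ho.
exists (Config (merged_tree s m) (rt \o node_root s)).
by apply/(roundP hs ho hrt); split.
Qed.

Lemma execution_clustering s0 r s : clustering s0 ->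
  execution V' E' w nid s0 r s ->
  clustering s /\ (#|cluster_roots V' s| * 2 ^ r <= #|cluster_roots V' s0|)%N.
Proof.
move=> hs0; elim=> [|{}r {}s m s' _ [hs le] /(round_clustering hs) [hs' le']].
  by rewrite muln1.
split=> //; apply: leq_trans le; rewrite expnS mulnA leq_mul2r le' orbT //.
Qed.

(** * Progress, termination and the best case *)

Hypothesis connE : connected_graph V' E'.

Lemma moe_exists s i : clustering s -> i \in cluster_roots V' s ->
  (exists u v, outgoing E' s i u v) -> exists p, is_moe E' w nid s i p.
Proof.
move=> hs iC [u0 [v0 o0]].
pose P (p : V * V) := outgoing E' s i p.1 p.2.
(* Minimise the weight over all outgoing edges, then the outer id among the lightest ones; the
   second minimum settles ties at the inner endpoint. *)
have [p Pp minp] := @arg_minP _ _ _ (u0, v0) P (fun p => w [set p.1; p.2]) o0.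
pose Q (q : V * V) := P q && (w [set q.1; q.2] == w [set p.1; p.2]).
have Qp : Q p by rewrite /Q [P p]Pp /=.
have [q /andP [Pq /eqP wq] minq] := arg_minnP (fun q => nid q.2) Qp.
exists q; split; last by move=> u v [ouv _]; rewrite wq; exact: (minp (u, v)).
split=> // v' ov'.
have : w [set q.1; q.2] <= w [set q.1; v'] by rewrite wq; exact: (minp (q.1, v')).
rewrite le_eqVlt => /predU1P [e|]; [right|by left].
by split=> //; apply: (minq (q.1, v')); rewrite /Q /P /= ov' -e wq eqxx.
Qed.

Lemma closed_cluster s i : clustering s -> i \in cluster_roots V' s ->
  (forall u v, ~~ outgoing E' s i u v) -> cluster_roots V' s = [set i].
Proof.
move=> hs iC no; have [iV ei] := (cluster_rootsP i hs).1 iC.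
apply/eqP; rewrite eqEsubset sub1set iC andbT.
apply/subsetP => _ /imsetP [v vV ->]; rewrite inE; apply/eqP.
have iv := connE.2 i v iV vV.
apply: (connect_ind (P := fun x => node_root s x = i) iv) => // x y xi xy.
by apply/eqP; have := no x y; rewrite outgoingE // xy xi eqxx /= negbK.
Qed.

(** By connectivity of [E'], a cluster without outgoing edge is the only cluster, and the
    configuration is then terminated; otherwise every cluster has an edge to select. *)
Lemma moe_choice_exists s : clustering s -> ~ terminated V' E' s ->
  exists m, moe_choice V' E' w nid s m.
Proof.
move=> hs nt.
have ex i : exists p, i \in cluster_roots V' s -> is_moe E' w nid s i p.
  have [iC|_] := boolP (i \in cluster_roots V' s); last by exists (i, i).
  suff /(moe_exists hs iC) [p hp] : exists u v, outgoing E' s i u v by exists p.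
  have [[u [v uv]]|no] := pselect (exists u v, outgoing E' s i u v).
    by exists u, v.
  exfalso; apply: nt.
  have no' u v : ~~ outgoing E' s i u v.
    by apply/negP => uv; apply: no; exists u, v.
  by move=> i' u v; rewrite (closed_cluster hs iC no') inE => /eqP ->.
by have [m hm] := choice ex; exists m.
Qed.

Lemma single_cluster s i : clustering s -> cluster_roots V' s = [set i] ->
  reconstructed V' E' s /\ terminated V' E' s.
Proof.
move=> hs e.
have iC : i \in cluster_roots V' s by rewrite e set11.
have ri v : v \in V' -> node_root s v = i.
  by move=> vV; apply/set1P; rewrite -e; exact: imset_f.
split; last first.
  move=> i' u v; rewrite e => /set1P ->; rewrite outgoingE //.
  by apply/negP => /and3P [/E'V' /ri ->]; rewrite eqxx.
exists i; split=> //.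
  apply/setP => v; rewrite in_cluster_of //.
  by case: (boolP (v \in V')) => // /ri ->; rewrite eqxx.
split; [exact: tree_edge | split; first exact: connE.1 | exact: tree_acyclic].
move=> u v /[dup] uV /ri eu /[dup] vV /ri ev.
apply: (@connect_trans _ _ i); last by rewrite -ev; exact: root_connect.
by rewrite connect_adj_sym -eu; exact: root_connect.
Qed.

Lemma terminated_reconstructed s : clustering s -> terminated V' E' s ->
  reconstructed V' E' s.
Proof.
move=> hs ht; have /set0Pn [v vV] := connE.1.
have rC : node_root s v \in cluster_roots V' s by exact: imset_f.
by have [] := single_cluster hs (closed_cluster hs rC (fun x y => ht _ x y rC)).
Qed.

(** [j] is the only leader, as every other cluster sends its merge message to it. *)
Lemma star_round s m s1 j : clustering s -> round V' E' w nid s m s1 ->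
  j \in cluster_roots V' s ->
  (forall i, i \in cluster_roots V' s -> (nid j <= nid i)%N) ->
  (forall i, i \in cluster_roots V' s -> i != j -> request V' s m i j) ->
  reconstructed V' E' s1 /\ terminated V' E' s1.
Proof.
move=> hs hround jC minj req; have [hm _ _ _] := hround.
have ho := moe_choice_outgoing hm.
have [d [rt hrt]] := exists_forest hs ho.
have [hs1 _] := round_clustering hs hround.
have [_ ht hr] := (roundP hs ho hrt s1).1 hround.
have tjC := target_root hs ho.
have minj' i : i \in cluster_roots V' s -> i != j -> (nid j < nid i)%N.
  move=> iC nij; rewrite ltn_neqAle minj // andbT.
  by apply: contraNneq nij => /nid_inj ->.
(* The message of [j] ascends, so that of its receiver goes to an id at most that of [j], that is,
   back to [j]. *)
have lj : leader nid (target s m) j.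
  rewrite /leader minj' ?tjC ?(target_neq hs ho) // andbT.
  have := target_ascent (m := m) jC; rewrite minj' ?tjC ?(target_neq hs ho) // => /(_ isT) le.
  by apply/eqP/nid_inj/eqP; rewrite eqn_leq le minj ?tjC ?tjC.
have rj : rt j = j by have := hrt j jC; rewrite lj.
apply: (single_cluster (i := j) hs1); apply/setP => x; rewrite inE.
apply/imsetP/eqP => [[v vV ->]|->]; last first.
  have [jV ej] := (cluster_rootsP j hs).1 jC.
  by exists j; rewrite // hr // ej.
rewrite hr //; set i := node_root s v; have iC : i \in cluster_roots V' s by exact: imset_f.
have [-> //|nij] := eqVneq i j.
(* A request kept by [i] can only come from [j], since all the others went to [j]; without one, [i]
   follows its own request, which goes to [j]. *)
have ti : target s m i = j.
  case: targetP => [i' /and3P [i'C /eqP ei' _] _|_]; last by have [] := req i iC nij.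
  have [//|/(req _ i'C) [_]] := eqVneq i' j.
  by rewrite ei' => e; rewrite e eqxx in nij.
have := hrt i iC; case: ifP => [/andP [_]|_ [_ <-]]; last by rewrite ti.
by rewrite ti ltnNge minj.
Qed.
End OneRound.

(** * The initial configuration *)

Lemma adj_remove_vertex (V : finType) (T : {set {set V}}) vf u v :
  adj (remove_vertex vf T) u v = [&& adj T u v, u != vf & v != vf].
Proof.
rewrite /adj /= inE; congr (_ && _).
by rewrite !inE negb_or ![vf == _]eq_sym.
Qed.

Lemma initial_clustering (V : finType) (E Ta : {set {set V}}) vf :
  Ta \subset E -> acyclic Ta -> (forall u v, connect (adj Ta) u v) ->
  clustering [set~ vf] (remove_vertex vf E) (initial_config Ta vf) /\
  (#|cluster_roots [set~ vf] (initial_config Ta vf)| <= degree Ta vf)%N.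
Proof.
move=> sTE acT conT; set F := remove_vertex vf Ta.
have sF : F \subset Ta by apply/subsetP => e; rewrite inE => /andP [].
have reach v : v != vf -> exists u, adj Ta vf u && connect (adj F) v u.
  move=> nv; pose P x := x = vf \/ exists u, adj Ta vf u && connect (adj F) x u.
  suff [ev|//] : P v by rewrite ev eqxx in nv.
  (* Follow a path of [Ta] from [vf]: the vertex after the last visit to [vf] is the required
     neighbour. *)
  apply: (connect_ind (conT vf v)); last by left.
  move=> x y Px xy; rewrite /P; have [->|ny] := eqVneq y vf; first by left.
  right; case: (eqVneq x vf) => [ex|nx].
    by exists y; rewrite connect0 -{1}ex xy.
  case: Px => [ex|[u /andP [hu xu]]]; first by rewrite ex eqxx in nx.
  exists u; rewrite hu /=; apply: connect_trans (connect1 _) xu.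
  by rewrite adj_sym adj_remove_vertex xy nx.
have rP v : v != vf -> adj Ta vf (node_root (initial_config Ta vf) v) &&
    connect (adj F) v (node_root (initial_config Ta vf) v).
  move=> /reach [u hu]; rewrite /=; case: pickP => //= /(_ u).
  by rewrite -/F hu.
split; last first.
  apply: subset_leq_card; apply/subsetP => _ /imsetP [v + ->].
  by rewrite !inE => /rP /andP [].
split.
- by apply/subsetP => e; rewrite !inE => /andP [/(subsetP sTE) ->].
- move=> c Uc cc; apply: acT => //.
  by apply: sub_cycle cc => x y; exact: (subsetP sF).
- move=> v; rewrite !inE => nv; have /andP [_ cv] := rP v nv.
  apply: (connect_ind (P := fun x => x != vf) cv) => // x y _.
  by rewrite adj_remove_vertex => /and3P [].
- move=> v; rewrite !inE => nv; have /andP [_ cv] := rP v nv.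
  by rewrite connect_adj_sym.
- move=> u v uv /=; have cuv : connect (adj F) u v by exact: connect1.
  (* [pick] depends only on the set of candidates, which the adjacent [u] and [v] share. The
     defaults [u] and [v] differ, but [reach] provides a candidate. *)
  have -> : [pick x | adj Ta vf x && connect (adj F) u x] =
            [pick x | adj Ta vf x && connect (adj F) v x].
    apply: eq_pick => x /=; congr (_ && _).
    by apply: same_connect => //; apply/sym_connect_sym/adj_sym.
  case: pickP => //= no.
  have /reach [x] : v != vf by move: uv; rewrite adj_remove_vertex => /and3P [].
  by rewrite no.
Qed.

(** * From powers of two to logarithms *)

Lemma ln2_ge_half (R : realType) : 1 <= 2 * ln (2 : R).
Proof.
(* [ln (1 + x) <= x] at [x = - 1/2] bounds [ln 2 = - ln (1/2)] from below. *)
have : ln (1 + - 2^-1 : R) <= - 2^-1 by apply: le_ln1Dx; rewrite ltrN2; lra.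
have -> : 1 + - 2^-1 = 2^-1 :> R by lra.
rewrite lnV ?posrE //; lra.
Qed.

Lemma exp2_le_ln (R : realType) (r k : nat) : (2 ^ r <= k)%N ->
  r%:R <= 2%:R * ln (k%:R : R).
Proof.
move=> le; have k0 : (0 < k)%N by apply: leq_trans le; rewrite expn_gt0.
have : ln ((2 ^ r)%:R : R) <= ln k%:R.
  by rewrite ler_ln ?posrE ?ltr0n ?expn_gt0 // ler_nat.
rewrite natrX lnXn // -[ln 2 *+ r]mulr_natr => h.
have := ln2_ge_half R; have : 0 <= r%:R :> R by [].
nra.
Qed.

(** The worst case bounds the length of every execution and adds that one not yet terminated can be
    continued whatever edges are selected; hence every execution can be extended to a reconstructed
    tree within the bound. *)
Theorem mainTheorem2 :
  exists C : nat,
  forall (R : realType) (V : finType) (nid : V -> nat)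
    (E : {set {set V}}) (w : {set V} -> R) (Ta : {set {set V}}) (vf : V),
  injective nid ->
  simple_graph E ->
  (forall e, e \in E -> 0 < w e) ->
  connected_graph [set: V] E ->
  min_spanning_tree [set: V] E w Ta ->
  let V' := [set~ vf] in
  let E' := remove_vertex vf E in
  let k := degree Ta vf in
  let n := #|V| in
  let s0 := initial_config Ta vf in
  connected_graph V' E' ->
  (* best case *)
  (forall (m : V -> V * V) (s1 : config V) (j : V),
     round V' E' w nid s0 m s1 ->
     j \in cluster_roots V' s0 ->
     (forall i, i \in cluster_roots V' s0 -> (nid j <= nid i)%N) ->
     (forall i, i \in cluster_roots V' s0 -> i != j -> request V' s0 m i j) ->
     reconstructed V' E' s1 /\ terminated V' E' s1) /\
  (* worst case *)
  (forall (r : nat) (s : config V),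
     execution V' E' w nid s0 r s ->
     [/\ r%:R <= C%:R * ln (k%:R : R),
         r%:R <= C%:R * ln (n%:R : R),
         terminated V' E' s -> reconstructed V' E' s
       & ~ terminated V' E' s ->
           (exists m, moe_choice V' E' w nid s m) /\
           (forall m, moe_choice V' E' w nid s m ->
              exists s', round V' E' w nid s m s')]).
Proof.
(* The constant is that of [1 <= 2 * ln 2]. *)
exists 2%N => R V nid E w Ta vf nid_inj _ _ _ [[sTE [_ conT] acT] _].
move=> V' E' k n s0 conE.
have [hs0 lek] := initial_clustering vf sTE acT
  (fun u v => conT u v (in_setT u) (in_setT v)).
have E'V' u v : adj E' u v -> v \in V'.
  by rewrite adj_remove_vertex !inE => /and3P [].
split=> [m s1 j|r s ex]; first exact: star_round.
have [hs le] := execution_clustering nid_inj E'V' hs0 ex.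
(* At least one cluster always remains, so the halving gives [2 ^ r <= k]. *)
have roots0 : (0 < #|cluster_roots V' s|)%N.
  have /set0Pn [v vV] := conE.1.
  by rewrite card_gt0; apply/set0Pn; exists (node_root s v); exact: imset_f.
have lerk : (2 ^ r <= k)%N.
  by apply: leq_trans (leq_trans le lek); rewrite leq_pmull.
split.
- exact: exp2_le_ln.
- by apply: exp2_le_ln; apply: leq_trans lerk (max_card _).
- exact: terminated_reconstructed.
- move=> nt; split; first exact: moe_choice_exists.
  by move=> m; exact: round_exists.
Qed.
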